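(* Let $f:\{\pm1\}^3\to\mathbb{R}$ have nonpositive agreement coefficients ($a_1\le 0$ and $a_{-1}\le0$) and be $g$-feasible for some nondecreasing $L$-Lipschitz $g:[-1,1]\to[-1,1]$. Let $S$ be a dataset and $\ell_S$ the associated loss. Then for any concept class $\mathcal{C}$ of functions $X\to\{\pm1\}$ and any sufficiently small $\varepsilon>0$, the algorithm $\textsc{Learn}(\ell_S,g,\varepsilon)$ halts within $O(\|f\|_\infty L/\varepsilon)$ iterations (regardless of the choices made in step (i)) and outputs a hypothesis $h$ satisfying $\max_{c\in\mathcal{C}}\ell_S(c,h)\le\varepsilon$.
   Context: $\mathrm{Rad}(m)$ for $m\in[-1,1]$ is the distribution on $\{\pm1\}$ equal to $+1$ with probability $\frac{1+m}{2}$. The multilinear extension of $f:\{\pm1\}^3\to\mathbb{R}$ is $\tilde f(c,h,y)=\mathbb{E}_{\mathbf{c}\sim\mathrm{Rad}(c),\mathbf{h}\sim\mathrm{Rad}(h),\mathbf{y}\sim\mathrm{Rad}(y)}[f(\mathbf{c},\mathbf{h},\mathbf{y})]$ for $c,h,y\in[-1,1]$ (independent draws). $\|f\|_\infty=\max|f|$. For a dataset $S=((x_1,y_1),\dots,(x_n,y_n))\in(X\times\{\pm1\})^n$ and functions $c,h:X\to[-1,1]$, $\ell_S(c,h)=\mathbb{E}_{(\mathbf{x},\mathbf{y})\sim\mathrm{Unif}(S)}[\tilde f(c(\mathbf{x}),h(\mathbf{x}),\mathbf{y})]$. The agreement coefficients are $a_y=f(1,1,y)+f(-1,-1,y)-f(1,-1,y)-f(-1,1,y)$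 for $y\in\{\pm1\}$. $f$ is $g$-feasible if $\tilde f(m,g(m),y)\le0$ for all $m\in[-1,1]$, $y\in\{\pm1\}$. Algorithm $\textsc{Learn}(\ell,g,\varepsilon)$: initialize $\mu_1=c$ for an arbitrary $c\in\mathcal{C}$. For $t=1,2,\dots$: (i) set $h_t=g\circ\mu_t$ and find any $c_t\in\mathcal{C}$ with $\ell(c_t,h_t)\ge\max_{c^\star\in\mathcal{C}}\ell(c^\star,h_t)-\varepsilon/20$; (ii) if $\ell(c_t,h_t)\le\frac{19}{20}\varepsilon$, output $h_t$; otherwise set $\mu_{t+1}=(1-\gamma)\mu_t+\gamma c_t$ with $\gamma=\frac{2}{t+2}$. *)

(* Defs.v *)
From HB Require Import structures.
From mathcomp Require Import all_boot all_order all_algebra.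
From mathcomp Require Import all_classical all_reals all_analysis.
Import Order.TTheory GRing.Theory Num.Theory.
Import numFieldNormedType.Exports.

Set Implicit Arguments.
Unset Strict Implicit.
Unset Printing Implicit Defensive.

Local Open Scope classical_set_scope.
Local Open Scope ring_scope.

(* The set {+1, -1} is represented by bool: true is +1 and false is -1. *)
Definition pm {R : realType} (b : bool) : R := if b then 1 else -1.

(* The probability mass function of Rad(m). *)
Definition rad {R : realType} (m : R) (b : bool) : R :=
  if b then (1 + m) / 2 else (1 - m) / 2.

Definition multilinear_ext {R : realType} (f : bool -> bool -> bool -> R)
    (c h y : R) : R :=
  \sum_(bc : bool) \sum_(bh : bool) \sum_(by_ : bool)
    rad c bc * rad h bh * rad y by_ * f bc bh by_.

(* Every term is nonnegative, so starting the maximum at 0 is harmless. *)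
Definition sup_norm {R : realType} (f : bool -> bool -> bool -> R) : R :=
  \big[Num.max/0]_(p : bool * bool * bool) `|f p.1.1 p.1.2 p.2|.

Definition agreement_coef {R : realType} (f : bool -> bool -> bool -> R)
    (y : bool) : R :=
  f true true y + f false false y - f true false y - f false true y.

(* A function [-1, 1] -> [-1, 1] is a total function on R of which only the
   values on [-1, 1] are constrained. *)
Definition feasible {R : realType} (f : bool -> bool -> bool -> R)
    (g : R -> R) : Prop :=
  forall (m : R) (y : bool), m \in `[-1, 1] ->
    multilinear_ext f m (g m) (pm y) <= 0.

Definition dataset_loss {R : realType} {X : Type} {n : nat}
    (f : bool -> bool -> bool -> R) (S : n.-tuple (X * bool))
    (c h : X -> R) : R :=
  n%:R^-1 * \sum_(i < n)
    multilinear_ext f (c (tnth S i).1) (h (tnth S i).1) (pm (tnth S i).2).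

Definition is_max {R : realType} (A : set R) (m : R) : Prop :=
  A m /\ ubound A m.

Section Learn.
Context {R : realType} {X : Type}.
Variables (C : set (X -> bool)) (l : (X -> R) -> (X -> R) -> R).
Variables (g : R -> R) (eps : R).

Definition concept_losses (h : X -> R) : set R :=
  [set l (pm \o c) h | c in C].

Definition admissible_choice (h : X -> R) (c : X -> bool) : Prop :=
  C c /\ exists2 m, is_max (concept_losses h) m & l (pm \o c) h >= m - eps / 20.

(* learn_reaches t mu: some execution of the algorithm, for some sequence of
   choices, begins iteration t with mu_t = mu. *)
Inductive learn_reaches : nat -> (X -> R) -> Prop :=
| learn_init c : C c -> learn_reaches 1 (pm \o c)
| learn_update t mu c :
    learn_reaches t mu ->
    admissible_choice (g \o mu) c ->
    l (pm \o c) (g \o mu) > 19 / 20 * eps ->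
    let gamma := 2 / (t%:R + 2) in
    learn_reaches t.+1 (fun x => (1 - gamma) * mu x + gamma * pm (c x)).

(* learn_outputs t h: some execution halts in iteration t with output h. *)
Definition learn_outputs (t : nat) (h : X -> R) : Prop :=
  exists mu c, [/\ learn_reaches t mu, h = g \o mu, admissible_choice h c
                 & l (pm \o c) h <= 19 / 20 * eps].

(* Every execution halts, in iteration at most N: step (i) can always be
   carried out, and no execution begins an iteration beyond the N-th. *)
Definition learn_halts_within (N : R) : Prop :=
  forall t mu, learn_reaches t mu ->
    t%:R <= N /\ exists c, admissible_choice (g \o mu) c.

End Learn.

(* Main.v *)
(* For a fixed label the derivative of the multilinear extension in its first
   argument, evaluated at (m, g m), is nonincreasing in m because the agreement
   coefficient is nonpositive and g is nondecreasing.  Hence it is the gradient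
   of a concave potential Phi with Lipschitz gradient, and the algorithm is
   Frank-Wolfe on Phi: the linear gain of the chosen c_t over mu_t is
   d_t = l(c_t, h_t) - l(mu_t, h_t), where l(mu_t, h_t) <= 0 by feasibility.
   As long as the algorithm runs, d_t >= 19/20 eps, while for every nu in the
   convex hull of C, d_t >= Phi(nu) - Phi(mu_t) - eps/20.  Averaging these two
   bounds with weights 1/4 and 3/4, the quantity
   r_t = Phi(nu) - Phi(mu_t) + 4/15 eps satisfies, for M = ||f||_oo,
   r_(t+1) <= (1 - 3/4 gamma) r_t + 4 M L gamma^2,
   so r_t <= 32 M L / (t+1) + 9 M / (t+1)^(3/2); the second term is what is left
   of the initial gap.  Taking for nu the current iterate mu_t itself gives
   4/15 eps <= 32 M L / (t+1) + 9 M / (t+1)^(3/2), which bounds t by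
   O(M L / eps) once eps <= M L^3. *)
Require Import Defs.
From mathcomp Require Import all_boot all_order all_algebra.
From mathcomp Require Import all_classical all_reals all_analysis.
From mathcomp Require Import measurable_realfun ring lra.
Import Order.TTheory GRing.Theory Num.Theory.
Import numFieldNormedType.Exports.

Set Implicit Arguments.
Unset Strict Implicit.
Unset Printing Implicit Defensive.

Local Open Scope classical_set_scope.
Local Open Scope ring_scope.

(** * Convex primitive of a nondecreasing function *)

(** [P] is the integral of [g] from [a]. Convexity is expressed by [g] being a subgradient of [P],
    so [g] may jump. *)
Lemma nondecreasing_convex_primitive (R : realType) (a b : R) (g : R -> R) :
  {in `[a, b] &, {homo g : x y / x <= y}} ->
  exists P : R -> R,
    {in `[a, b] &, forall x y, g x * (y - x) <= P y - P x}.
Proof.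
move=> g_nd.
have [ab|ba] := leP a b; last first.
  exists g => x y; rewrite in_itv/= => /andP[ax xb].
  by move: ba; rewrite ltNge (le_trans ax xb).
(* Composing with the projection onto [[a, b]] extends [g] to a nondecreasing, hence measurable,
   function on the whole line. *)
pose clamp t : R := Num.max a (Num.min b t).
have clampE t : t \in `[a, b] -> clamp t = t.
  by rewrite in_itv/= /clamp => /andP[at_ tb]; rewrite min_r// max_r.
have clamp_in t : clamp t \in `[a, b].
  by rewrite in_itv/= /clamp le_max lexx/= ge_max ab ge_min lexx.
have clamp_nd s t : s <= t -> clamp s <= clamp t.
  move=> st; rewrite /clamp ge_max le_max lexx/= le_max; apply/orP; right.
  by rewrite le_min !ge_min lexx st/= orbT.
pose G t := g (clamp t).
have G_nd : nondecreasing_fun G by move=> s t st; apply: g_nd => //; exact: clamp_nd.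
have G_int x y : (@lebesgue_measure R).-integrable `[x, y] (EFin \o G).
  apply: measurable_bounded_integrable => //=.
  - by rewrite lebesgue_measure_itv/=; case: ifPn => // _; rewrite -EFinB ltry.
  - exact: nondecreasing_measurable.
  - exists (`|g a| + `|g b|); split; first exact: num_real.
    move=> M /ltW ltM t _ /=; apply: le_trans ltM.
    have aI : a \in `[a, b] by rewrite in_itv/= lexx.
    have bI : b \in `[a, b] by rewrite in_itv/= lexx ab.
    have := clamp_in t; rewrite in_itv/= => /andP[at_ tb].
    have ga : g a <= G t by exact: g_nd.
    have gb : G t <= g b by exact: g_nd.
    rewrite ler_norml; have := ler_norm (g b); have := ler_norm (- g a).
    rewrite normrN; have := normr_ge0 (g a); have := normr_ge0 (g b); lra.
pose P y := \int[@lebesgue_measure R]_(t in `[a, y]) G t.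
(* Monotonicity bounds the integral by both endpoint values: the lower bound serves points to the
   right of the base point, the upper one those to the left. *)
have PB x y : a <= x -> x <= y ->
    G x * (y - x) <= P y - P x <= G y * (y - x).
  move=> ax xy; rewrite /P Rintegral_itvB ?bnd_simp//.
  have Gxy : (@lebesgue_measure R).-integrable `]x, y] (EFin \o G).
    by apply: integrableS (G_int x y) => //; exact: subset_itv_oc_cc.
  have cst_int r : (@lebesgue_measure R).-integrable `]x, y] (EFin \o cst r).
    apply: measurable_bounded_integrable => //=; last exact: bounded_cst.
    by rewrite lebesgue_measure_itv/=; case: ifPn => // _; rewrite -EFinB ltry.
  have cstE r : r * (y - x) = \int[@lebesgue_measure R]_(t in `]x, y]) (cst r t).
    rewrite Rintegral_cst//= lebesgue_measure_itv/= lte_fin.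
    by move: xy; rewrite le_eqVlt => /predU1P[->|->]//=; rewrite ltxx subrr.
  rewrite !cstE; apply/andP; split; apply: le_Rintegral => // t;
    by rewrite /= in_itv/= => /andP[xt ty]; apply: G_nd => //; exact: ltW.
exists P => x y xI yI.
have /andP[ax xb] := xI; have /andP[ay yb] := yI.
have -> : g x = G x by rewrite /G clampE.
have [xy|/ltW yx] := leP x y.
  by have /andP[] := PB _ _ ax xy.
by have /andP[] := PB _ _ ay yx; lra.
Qed.

(** The loss sees a concept only through its labels on the [n] sample points, so even an infinite
    [C] yields finitely many values. *)
Lemma is_max_concept_losses (R : realType) (X : Type) (n : nat)
    (f : bool -> bool -> bool -> R) (S : n.-tuple (X * bool))
    (C : set (X -> bool)) (h : X -> R) :
  C !=set0 -> exists m, is_max (concept_losses C (dataset_loss f S) h) m.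
Proof.
move=> [c0 Cc0].
pose restr (c : X -> bool) : {ffun 'I_n -> bool} := [ffun i => c (tnth S i).1].
pose realized v := `[< exists2 c, C c & restr c = v >].
pose loss (v : {ffun 'I_n -> bool}) : R :=
  n%:R^-1 * \sum_(i < n)
    multilinear_ext f (pm (v i)) (h (tnth S i).1) (pm (tnth S i).2).
have lossE c : loss (restr c) = dataset_loss f S (pm \o c) h.
  by rewrite /loss; under eq_bigr do rewrite ffunE.
have realized0 : realized (restr c0) by apply/asboolP; exists c0.
case: (arg_maxP loss realized0) => v /asboolP[c Cc <-{v}] c_max.
exists (loss (restr c)); split; first by exists c => //; rewrite lossE.
move=> _ [c' Cc' <-]; rewrite -lossE; apply: c_max.
by apply/asboolP; exists c'.
Qed.

(** * The multilinear extension at a fixed label *)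

(** The derivative of the multilinear extension in its first argument. *)
Definition slope {R : realType} (f : bool -> bool -> bool -> R) (y : bool)
    (h : R) : R :=
  ((f true true y - f false true y) * (1 + h) +
   (f true false y - f false false y) * (1 - h)) / 4.

Section Multilinear.
Context {R : realType}.
Variable f : bool -> bool -> bool -> R.

Lemma multilinear_ext_pm c h y :
  multilinear_ext f c h (pm y) =
    (f true true y * (1 + c) * (1 + h) + f true false y * (1 + c) * (1 - h) +
     f false true y * (1 - c) * (1 + h) + f false false y * (1 - c) * (1 - h))
    / 4.
Proof.
by rewrite /multilinear_ext !big_bool/= /rad /pm; case: y => /=; field.
Qed.

Lemma multilinear_extB c c' h y :
  multilinear_ext f c h (pm y) - multilinear_ext f c' h (pm y) =
  slope f y h * (c - c').
Proof. by rewrite !multilinear_ext_pm /slope; field. Qed.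

(** Up to the factor 4, the agreement coefficient is the mixed second derivative; its sign decides
    whether the slope falls as [h] grows. *)
Lemma slope_agreement h y :
  slope f y h = slope f y 0 + agreement_coef f y / 4 * h.
Proof. by rewrite /slope /agreement_coef; field. Qed.

Lemma sup_norm_ub a b y : `|f a b y| <= sup_norm f.
Proof. exact: (le_bigmax 0 (fun p => `|f p.1.1 p.1.2 p.2|) (a, b, y)). Qed.

Lemma sup_norm_ge0 : 0 <= sup_norm f.
Proof. exact: le_trans (sup_norm_ub true true true). Qed.

Lemma sup_norm_itv a b y : - sup_norm f <= f a b y <= sup_norm f.
Proof. by rewrite -ler_norml sup_norm_ub. Qed.

Lemma slope_bound h y : h \in `[-1, 1] -> `|slope f y h| <= sup_norm f.
Proof.
rewrite in_itv/= => /andP[h1 h2].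
have := sup_norm_itv true true y; have := sup_norm_itv true false y.
have := sup_norm_itv false true y; have := sup_norm_itv false false y.
rewrite ler_norml /slope.
by move=> /andP[? ?] /andP[? ?] /andP[? ?] /andP[? ?]; apply/andP; split; nra.
Qed.

Lemma agreement_coef_bound y : `|agreement_coef f y / 4| <= sup_norm f.
Proof.
have := sup_norm_itv true true y; have := sup_norm_itv true false y.
have := sup_norm_itv false true y; have := sup_norm_itv false false y.
by rewrite ler_norml /agreement_coef; lra.
Qed.

Lemma multilinear_ext_hB c h h' y : c \in `[-1, 1] ->
  multilinear_ext f c h (pm y) - multilinear_ext f c h' (pm y) <=
  sup_norm f * `|h - h'|.
Proof.
rewrite in_itv/= => /andP[c1 c2]; rewrite !multilinear_ext_pm.
set u := ((f true true y - f true false y) * (1 + c) +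
          (f false true y - f false false y) * (1 - c)) / 4.
set d := (X in X <= _).
have -> : d = u * (h - h') by rewrite /d /u; field.
apply: le_trans (ler_norm _) _; rewrite normrM ler_wpM2r//.
have := sup_norm_itv true true y; have := sup_norm_itv true false y.
have := sup_norm_itv false true y; have := sup_norm_itv false false y.
rewrite ler_norml /u.
by move=> /andP[? ?] /andP[? ?] /andP[? ?] /andP[? ?]; apply/andP; split; nra.
Qed.

End Multilinear.

(** * The scalar recursion for the gap *)

(** With [s = t + 1] and [gamma = 2 / (s + 1)], the factor is [1 - 3/4 gamma] and the error is
    [4 D gamma^2]. The two terms of the bound propagate separately: the first absorbs the error, the
    second only has to follow the contraction. *)
Lemma gap_bound_step (R : realType) (D B s r r' : R) :
  0 <= D -> 0 <= B -> 2 <= s ->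
  r <= 32 * D / s + B / (s * Num.sqrt s) ->
  r' <= r * (1 - 3 / (2 * (s + 1))) + 16 * D / (s + 1) ^+ 2 ->
  r' <= 32 * D / (s + 1) + B / ((s + 1) * Num.sqrt (s + 1)).
Proof.
move=> D0 B0 s2 rB r'B; have s0 : 0 < s by lra.
have s10 : 0 < s + 1 by lra.
set u := Num.sqrt s in rB *; set v := Num.sqrt (s + 1) in r'B *.
have u0 : 0 < u by rewrite sqrtr_gt0.
have v0 : 0 < v by rewrite sqrtr_gt0.
have c0 : 0 <= 1 - 3 / (2 * (s + 1)).
  have -> : 1 - 3 / (2 * (s + 1)) = (s - 1 / 2) / (s + 1) by field; lra.
  by rewrite divr_ge0//; lra.
have /le_trans := le_trans r'B (lerD (ler_wpM2r c0 rB) (lexx _)); apply.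
(* This says [1 - 3 / (2 (s + 1)) <= (s / (s + 1))^(3/2)], whence the exponent 3/2. *)
have uv : (s - 1 / 2) * v <= s * u.
  rewrite -ler_sqr ?nnegrE; [|by apply: mulr_ge0; lra|by apply: mulr_ge0; lra].
  by rewrite !exprMn !sqr_sqrtr; nra.
rewrite mulrDl [leLHS]addrAC; apply: lerD.
  rewrite -subr_ge0.
  have -> : 32 * D / (s + 1) - (32 * D / s * (1 - 3 / (2 * (s + 1))) +
      16 * D / (s + 1) ^+ 2) = 16 * D / (s * (s + 1) ^+ 2).
    by field; lra.
  by apply: divr_ge0; [lra|apply: mulr_ge0; [lra|exact: sqr_ge0]].
rewrite -mulrA ler_wpM2l//.
have -> : (s * u)^-1 * (1 - 3 / (2 * (s + 1))) =
          (s - 1 / 2) * v / (s * u * ((s + 1) * v)) by field; lra.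
have -> : ((s + 1) * v)^-1 = s * u / (s * u * ((s + 1) * v)) by field; lra.
by rewrite ler_pM2r// invr_gt0 !mulr_gt0.
Qed.

Lemma gap_bound_solve (R : realType) (M L eps s : R) :
  0 < M -> 0 < L -> 0 < eps -> eps <= M * L ^+ 3 -> 1 <= s ->
  4 / 15 * eps <= 32 * (M * L) / s + 9 * M / (s * Num.sqrt s) ->
  s <= 240 * (M * L / eps).
Proof.
move=> M0 L0 eps0 epsL s1; have s0 : 0 < s by lra.
set z := Num.sqrt s; have z0 : 0 < z by rewrite sqrtr_gt0.
have sz : s = z ^+ 2 by rewrite sqr_sqrtr// ltW.
rewrite [240 * _]mulrA ler_pdivlMr//.
have ML0 : 0 < M * L by rewrite mulr_gt0.
have -> : 32 * (M * L) / s + 9 * M / (s * z) =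
          (32 * (M * L) * z + 9 * M) / (s * z) by field; lra.
rewrite ler_pdivlMr ?mulr_gt0// => H.
(* Which term dominates? If the first, doubling it gives the constant [64 * 15 / 4 = 240]. Otherwise
   [L * z < 1], and the smallness of [eps] already gives [s * eps <= M * L]. *)
have [Lz|Lz] := leP 9 (32 * L * z).
  have H1 : 4 / 15 * eps * (s * z) <= 64 * (M * L) * z by nra.
  have : (4 / 15 * eps * s - 64 * (M * L)) * z <= 0 by lra.
  by rewrite pmulr_lle0//; lra.
have Lz1 : (L * z) ^+ 2 <= 1.
  by rewrite -[leRHS](expr1n _ 2) ler_sqr ?nnegrE; [lra|nra|lra].
have : s * eps <= M * L * (L * z) ^+ 2.
  have -> : M * L * (L * z) ^+ 2 = z ^+ 2 * (M * L ^+ 3) by ring.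
  by rewrite sz ler_wpM2l// sqr_ge0.
by nra.
Qed.

(** * Averages over the dataset *)

Definition cube {R : realType} {X : Type} (mu : X -> R) : Prop :=
  forall x, mu x \in `[-1, 1].

Lemma cube_pm {R : realType} {X : Type} (c : X -> bool) :
  cube (pm \o c : X -> R).
Proof. by move=> x; rewrite in_itv/= /pm; case: (c x); lra. Qed.

Lemma le_mean (R : realType) (n : nat) (F G : 'I_n -> R) :
  (forall i, F i <= G i) ->
  n%:R^-1 * \sum_(i < n) F i <= n%:R^-1 * \sum_(i < n) G i.
Proof. by move=> FG; rewrite ler_wpM2l ?invr_ge0// ler_sum. Qed.

Lemma mean_cst (R : realType) (n : nat) (r : R) :
  (0 < n)%N -> n%:R^-1 * \sum_(i < n) r = r.
Proof.
move=> n0; rewrite sumr_const card_ord -[r *+ n]mulr_natl mulKf//.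
by rewrite pnatr_eq0 -lt0n.
Qed.

Lemma mean_le_cst (R : realType) (n : nat) (F : 'I_n -> R) (r : R) :
  (0 < n)%N -> (forall i, F i <= r) -> n%:R^-1 * \sum_(i < n) F i <= r.
Proof. by move=> n0 Fr; rewrite -[leRHS](@mean_cst _ n)//; exact: le_mean. Qed.

Section DatasetLoss.
Context {R : realType} {X : Type} {n : nat}.
Variables (f : bool -> bool -> bool -> R) (S : n.-tuple (X * bool)).

Lemma dataset_lossB (c c' h : X -> R) :
  dataset_loss f S c h - dataset_loss f S c' h =
  n%:R^-1 * \sum_(i < n) slope f (tnth S i).2 (h (tnth S i).1) *
    (c (tnth S i).1 - c' (tnth S i).1).
Proof.
rewrite /dataset_loss -mulrBr -sumrB; congr (_ * _).
by apply: eq_bigr => i _; rewrite multilinear_extB.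
Qed.

Lemma dataset_loss_convex (mu c h : X -> R) (r : R) :
  dataset_loss f S (fun x => (1 - r) * mu x + r * c x) h =
  (1 - r) * dataset_loss f S mu h + r * dataset_loss f S c h.
Proof.
suff H : dataset_loss f S (fun x => (1 - r) * mu x + r * c x) h -
    dataset_loss f S mu h =
    r * (dataset_loss f S c h - dataset_loss f S mu h) by lra.
rewrite !dataset_lossB mulrCA [r * _]mulr_sumr; congr (_ * _).
by apply: eq_bigr => i _; ring.
Qed.

Lemma dataset_loss_diff_bound (c c' h : X -> R) :
  (0 < n)%N -> cube c -> cube c' -> cube h ->
  dataset_loss f S c h - dataset_loss f S c' h <= 2 * sup_norm f.
Proof.
move=> n0 cI c'I hI; rewrite dataset_lossB; apply: mean_le_cst => // i.
apply: le_trans (ler_norm _) _; rewrite normrM mulrC.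
apply: ler_pM => //; last exact: slope_bound.
have := cI (tnth S i).1; have := c'I (tnth S i).1.
by rewrite !in_itv/= ler_norml; lra.
Qed.

End DatasetLoss.

(** * The concave potential *)

(** With [P] a primitive of [g], each summand is a primitive of [slope f y (g m)] in [m], split as
    in [slope_agreement]. *)
Definition potential {R : realType} {X : Type} {n : nat}
    (f : bool -> bool -> bool -> R) (P : R -> R) (S : n.-tuple (X * bool))
    (mu : X -> R) : R :=
  n%:R^-1 * \sum_(i < n)
    (slope f (tnth S i).2 0 * mu (tnth S i).1 +
     agreement_coef f (tnth S i).2 / 4 * P (mu (tnth S i).1)).

Section Potential.
Context {R : realType} {X : Type} {n : nat}.
Variables (f : bool -> bool -> bool -> R) (L : R) (g P : R -> R).
Variable S : n.-tuple (X * bool).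
Hypothesis agreement_le0 : forall y, agreement_coef f y <= 0.
Hypothesis P_subgradient :
  {in `[-1, 1] &, forall x y, g x * (y - x) <= P y - P x}.

(** First-order concavity: the linearization at [mu] lies above the potential. *)
Lemma potential_le (mu nu : X -> R) : cube mu -> cube nu ->
  potential f P S nu - potential f P S mu <=
  dataset_loss f S nu (g \o mu) - dataset_loss f S mu (g \o mu).
Proof.
move=> muI nuI; rewrite dataset_lossB /potential -mulrBr -sumrB.
apply: le_mean => i; set x := (tnth S i).1; set y := (tnth S i).2.
rewrite /= [slope _ _ (g _)]slope_agreement.
have a_le0 : agreement_coef f y / 4 <= 0 by have := agreement_le0 y; lra.
by have := ler_wnM2l a_le0 (P_subgradient (muI x) (nuI x)); lra.
Qed.

(** The curvature bound for a Frank-Wolfe step. The subgradient of [P] is taken at [nu]; replacing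
    [g (nu x)] by [g (mu x)] costs at most [L * D ^+ 2]. *)
Lemma potential_ge (mu nu : X -> R) (D : R) : (0 < n)%N -> 0 <= L ->
  {in `[-1, 1] &, forall x y, `|g x - g y| <= L * `|x - y|} ->
  cube mu -> cube nu -> (forall x, `|nu x - mu x| <= D) ->
  dataset_loss f S nu (g \o mu) - dataset_loss f S mu (g \o mu)
    - sup_norm f * L * D ^+ 2 <=
  potential f P S nu - potential f P S mu.
Proof.
move=> n0 L0 g_lip muI nuI nu_mu.
rewrite dataset_lossB /potential -mulrBr -sumrB.
rewrite -[X in _ - X](@mean_cst _ n)// -mulrBr -sumrB.
apply: le_mean => i; set x := (tnth S i).1; set y := (tnth S i).2.
rewrite /= [slope _ _ (g _)]slope_agreement; have := P_subgradient (nuI x) (muI x).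
have a0 : agreement_coef f y / 4 <= 0 by have := agreement_le0 y; lra.
have := agreement_coef_bound f y; rewrite ler_norml => /andP[aM _].
set a := agreement_coef f y / 4 in a0 aM *.
have gD : (g (nu x) - g (mu x)) * (nu x - mu x) <= L * D ^+ 2.
  apply: le_trans (ler_norm _) _; rewrite normrM expr2 mulrA.
  apply: ler_pM => //; apply: le_trans (g_lip _ _ (nuI x) (muI x)) _.
  by rewrite ler_wpM2l.
have LD0 : 0 <= L * D ^+ 2 by rewrite mulr_ge0// sqr_ge0.
move=> PD.
have : P (nu x) - P (mu x) <= g (mu x) * (nu x - mu x) + L * D ^+ 2 by lra.
by move=> /(ler_wnM2l a0); have := ler_wpM2r LD0 aM; lra.
Qed.

Lemma dataset_loss_le0 (mu : X -> R) : (0 < n)%N -> feasible f g ->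
  cube mu -> dataset_loss f S mu (g \o mu) <= 0.
Proof. by move=> n0 f_feas muI; apply: mean_le_cst => // i; exact: f_feas. Qed.

(** Feasibility applies at [g (c x)], and the Lipschitz bound pays for moving to [g (mu x)]. This
    rules out a second iteration when [sup_norm f * L = 0]. *)
Lemma dataset_loss_bound (mu c : X -> R) : (0 < n)%N -> 0 <= L ->
  {in `[-1, 1] &, forall x y, `|g x - g y| <= L * `|x - y|} ->
  feasible f g -> cube mu -> cube c ->
  dataset_loss f S c (g \o mu) <= 2 * (sup_norm f * L).
Proof.
move=> n0 L0 g_lip f_feas muI cI; apply: mean_le_cst => // i.
set x := (tnth S i).1; set y := (tnth S i).2.
rewrite -[leLHS](subrK (multilinear_ext f (c x) (g (c x)) (pm y))).
rewrite -[leRHS]addr0; apply: lerD; last exact: f_feas.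
apply: le_trans (multilinear_ext_hB _ _ _ _ (cI x)) _.
rewrite mulrCA; apply: ler_wpM2l; first exact: sup_norm_ge0.
apply: le_trans (g_lip _ _ (muI x) (cI x)) _; rewrite mulrC ler_wpM2r//.
by have := muI x; have := cI x; rewrite !in_itv/= ler_norml; lra.
Qed.

End Potential.

(** * Executions of the algorithm *)

Section Reach.
Context {R : realType} {X : Type} {n : nat}.
Variables (f : bool -> bool -> bool -> R) (L : R) (g P : R -> R).
Variables (S : n.-tuple (X * bool)) (C : set (X -> bool)) (eps : R).

Lemma learn_reaches_gt0 t mu :
  learn_reaches C (dataset_loss f S) g eps t mu -> (0 < t)%N.
Proof. by case. Qed.

Lemma learn_reaches_inhabited t mu :
  learn_reaches C (dataset_loss f S) g eps t mu -> C !=set0.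
Proof. by elim=> // c Cc; exists c. Qed.

Lemma step_size_itv t : 0 <= 2 / (t%:R + 2 : R) <= 1.
Proof.
have t0 : 0 <= t%:R :> R by [].
by rewrite divr_ge0 ?addr_ge0//= ler_pdivrMr; lra.
Qed.

Lemma learn_reaches_cube t mu :
  learn_reaches C (dataset_loss f S) g eps t mu -> cube mu.
Proof.
elim=> [c _|{}t {}mu c _ muI _ _ gamma x]; first exact: cube_pm.
have := cube_pm (R := R) c x; have := muI x; have := step_size_itv t.
rewrite -/gamma !in_itv/= => /andP[? ?] /andP[? ?] /andP[? ?].
by apply/andP; split; nra.
Qed.

(* Every convex combination of concepts has this property, which is all that
   the analysis uses of the convex hull of [C]. *)
Definition dominated (nu : X -> R) : Prop :=
  forall h m, ubound (concept_losses C (dataset_loss f S) h) m ->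
  dataset_loss f S nu h <= m.

Lemma learn_reaches_dominated t mu :
  learn_reaches C (dataset_loss f S) g eps t mu -> dominated mu.
Proof.
elim=> [c Cc h m|{}t {}mu c _ muD [Cc _] _ gamma h m] ub_m.
  by apply: ub_m; exists c.
rewrite (dataset_loss_convex f S mu (pm \o c)).
have := muD h m ub_m.
have : dataset_loss f S (pm \o c) h <= m by apply: ub_m; exists c.
by have := step_size_itv t; rewrite -/gamma => /andP[? ?] ? ?; nra.
Qed.

Hypothesis n_gt0 : (0 < n)%N.
Hypothesis L_ge0 : 0 <= L.
Hypothesis agreement_le0 : forall y, agreement_coef f y <= 0.
Hypothesis g_itv : {in `[-1, 1], forall m, g m \in `[-1, 1]}.
Hypothesis g_lip : {in `[-1, 1] &, forall x y, `|g x - g y| <= L * `|x - y|}.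
Hypothesis f_feasible : feasible f g.
Hypothesis P_subgradient :
  {in `[-1, 1] &, forall x y, g x * (y - x) <= P y - P x}.
Hypothesis eps_le : eps <= sup_norm f.

(* The constant 4/15 turns the lower bound
   [3/4 (gap - eps/20) + 1/4 (19/20 eps)] on the progress of a step into
   [3/4 (gap + 4/15 eps)]. *)
Lemma learn_reaches_gap t mu nu :
  cube nu -> dominated nu ->
  learn_reaches C (dataset_loss f S) g eps t mu ->
  potential f P S nu - potential f P S mu + 4 / 15 * eps <=
  32 * (sup_norm f * L) / (t%:R + 1) +
  9 * sup_norm f / ((t%:R + 1) * Num.sqrt (t%:R + 1)).
Proof.
move=> nuI nuD; have M0 := sup_norm_ge0 f.
have ML0 : 0 <= sup_norm f * L by exact: mulr_ge0.
elim=> [c _|{}t {}mu c mu_t gap c_adm c_large gamma].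
  (* Initially the gap is at most [2 M + 4/15 eps <= 3 M], where [M = sup_norm f]. Since
     [sqrt 2 <= 3/2], the constant 9 makes the second term at least [3 M] at [t = 1]. *)
  have cI := cube_pm (R := R) c.
  have gcI : cube (g \o (pm \o c)) by move=> x; exact: g_itv.
  have := potential_le S agreement_le0 P_subgradient cI nuI.
  have := dataset_loss_diff_bound f S n_gt0 nuI cI gcI.
  set w := Num.sqrt _; have w0 : 0 < w by rewrite sqrtr_gt0.
  have w2 : w <= 3 / 2.
    by rewrite -ler_sqr ?nnegrE; [rewrite sqr_sqrtr//; lra|exact: ltW|lra].
  have : 3 * sup_norm f <= 9 * sup_norm f / ((1 + 1) * w).
    by rewrite ler_pdivlMr ?mulr_gt0//; nra.
  have : 0 <= 32 * (sup_norm f * L) / (1 + 1) by rewrite divr_ge0// mulr_ge0.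
  by have := eps_le; lra.
have muI := learn_reaches_cube mu_t.
have t1 : 1 <= t%:R :> R by rewrite ler1n (learn_reaches_gt0 mu_t).
have cI := cube_pm (R := R) c.
pose mu' x := (1 - gamma) * mu x + gamma * pm (c x).
have mu'I : cube mu' := learn_reaches_cube (learn_update mu_t c_adm c_large).
have [Cc [m [_ m_ub] c_m]] := c_adm.
have /andP[gamma0 gamma1] := step_size_itv t; rewrite -/gamma in gamma0 gamma1.
have mu'_mu x : `|mu' x - mu x| <= 2 * gamma.
  have -> : mu' x - mu x = (pm (c x) - mu x) * gamma by rewrite /mu'; ring.
  rewrite normrM (ger0_norm gamma0) ler_wpM2r//.
  by have := muI x; have := cI x; rewrite !in_itv/= ler_norml; lra.
have := potential_ge S agreement_le0 P_subgradient n_gt0 L_ge0 g_lip muI mu'I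
  mu'_mu.
rewrite (dataset_loss_convex f S mu (pm \o c)) => progress.
have nu_le := potential_le S agreement_le0 P_subgradient muI nuI.
have nu_m := nuD (g \o mu) m m_ub.
have mu_le0 := dataset_loss_le0 S n_gt0 f_feasible muI.
rewrite -[t.+1%:R]natr1.
apply: (gap_bound_step ML0 _ _ gap); [exact: mulr_ge0|lra|].
have -> : 3 / (2 * (t%:R + 1 + 1)) = 3 / 4 * gamma :> R.
  by rewrite /gamma; field; lra.
have -> : 16 * (sup_norm f * L) / (t%:R + 1 + 1) ^+ 2 =
          sup_norm f * L * (2 * gamma) ^+ 2.
  by rewrite /gamma; field; lra.
(* Weight 3/4 goes to the near-optimality of [c] against [nu], weight 1/4 to the failed stopping
   test combined with feasibility. *)
have : 3 / 4 * (potential f P S nu - potential f P S mu + 4 / 15 * eps) <=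
    dataset_loss f S (pm \o c) (g \o mu) - dataset_loss f S mu (g \o mu) by lra.
move=> /(ler_wpM2l gamma0); rewrite -/mu'; nra.
Qed.

End Reach.

(** * Iteration bound and guarantee for the output *)

Theorem theorem5p3 (R : realType) :
  exists2 K : R, 0 < K &
  forall (f : bool -> bool -> bool -> R) (L : R),
    (forall y : bool, agreement_coef f y <= 0) ->
  exists2 eps0 : R, 0 < eps0 &
  forall g : R -> R,
    {in `[-1, 1], forall m, g m \in `[-1, 1]} ->
    {in `[-1, 1] &, {homo g : x y / x <= y}} ->
    L.-lipschitz_(`[-1, 1]%classic) g ->
    feasible f g ->
  forall (X : Type) (n : nat) (S : n.-tuple (X * bool)) (C : set (X -> bool))
    (eps : R),
    (0 < n)%N -> 0 < eps -> eps <= eps0 ->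
    learn_halts_within C (dataset_loss f S) g eps
      (Num.max 1 (K * (sup_norm f * L / eps))) /\
    (forall (t : nat) (h : X -> R),
      learn_outputs C (dataset_loss f S) g eps t h ->
      exists2 m, is_max (concept_losses C (dataset_loss f S) h) m & m <= eps).
Proof.
exists 240; first by [].
move=> f L a0; set M := sup_norm f.
(* [eps <= M] serves the initial gap, [eps <= M * L ^+ 3] the solution of the final inequality. If
   [M * L <= 0], the default 1 suffices, as the run halts in iteration 1. *)
exists (if 0 < M * L then Num.min M (M * L ^+ 3) else 1).
  case: ifPn => // ML0; have M0 := sup_norm_ge0 f; rewrite -/M in M0.
  have L0 : 0 < L.
    by rewrite ltNge; apply: contraL ML0 => L0; rewrite -leNgt mulr_ge0_le0.
  have {}M0 : 0 < M by rewrite -(pmulr_lgt0 _ L0).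
  by rewrite lt_min M0 mulr_gt0// exprn_gt0.
move=> g g_itv g_nd g_lip' f_feas X n S C eps n0 eps_gt0 eps_le.
have g_lip : {in `[-1, 1] &, forall x y, `|g x - g y| <= L * `|x - y|}.
  by move=> x y xI yI; exact: (g_lip' (x, y)).
have L0 : 0 <= L.
  have I1 : 1 \in `[-1, 1 : R] by rewrite in_itv/=; lra.
  have IN1 : -1 \in `[-1, 1 : R] by rewrite in_itv/=; lra.
  have := le_trans (normr_ge0 _) (g_lip _ _ I1 IN1).
  by rewrite pmulr_lge0// normr_gt0; lra.
split; last first.
  by move=> t h [mu [c [_ _ [_ [m m_max cm]] c_le]]]; exists m => //; lra.
move=> t mu mu_t; split; last first.
  have [m m_max] :=
    is_max_concept_losses f S (g \o mu) (learn_reaches_inhabited mu_t).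
  have [[c Cc cm] _] := m_max.
  by exists c; split=> //; exists m => //; rewrite cm; lra.
rewrite le_max; have [//|t1/=] := leP t%:R 1.
(* Entering an iteration after the first means that some choice had loss above [19/20 eps], while
   every loss is at most [2 * (M * L)]. *)
have ML0 : 0 < M * L.
  case: mu_t t1 => [c _|{}t {}mu c mu_t _ c_large gamma _]; first by rewrite ltxx.
  have muI := learn_reaches_cube mu_t.
  have := dataset_loss_bound S n0 L0 g_lip f_feas muI (cube_pm c).
  by rewrite -/M; lra.
move: eps_le; rewrite ML0 le_min => /andP[epsM epsL].
have Lp : 0 < L.
  by rewrite lt_neqAle L0 andbT; apply: contraTneq ML0 => <-; rewrite mulr0 ltxx.
have Mp : 0 < M by rewrite -(pmulr_lgt0 _ Lp).
have [P P_sub] := nondecreasing_convex_primitive g_nd.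
have muI := learn_reaches_cube mu_t.
have muD := learn_reaches_dominated mu_t.
have := learn_reaches_gap n0 L0 a0 g_itv g_lip f_feas P_sub epsM muI muD
  mu_t.
rewrite subrr add0r => /(gap_bound_solve Mp Lp eps_gt0 epsL) bound.
by apply: le_trans (bound _); lra.
Qed.
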